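(* Let $n\ge 4$ and $q\ge 2$ be integers, and let $(r_1,\ldots,r_n),(c_1,\ldots,c_n)\in(\mathbb{Z}/q\mathbb{Z})^n$ satisfy $\sum_i r_i=\sum_j c_j$. Let $(C^1_t,C^2_t)_{t\ge0}$ be any Markovian coupling of two copies of the Diaconis--Gangolli walk on the $n\times n$ contingency tables over $\mathbb{Z}/q\mathbb{Z}$ with row sums $(r_i)$ and column sums $(c_j)$, started from two distinct states $C^1_0\ne C^2_0$, and let $T=\min\{t: C^1_t=C^2_t\}$ be its coupling time. Then $$\mathbb{P}\left(T>\frac{n^3}{100}\right)\ge\frac12.$$
   Context: A contingency table over $\mathbb{Z}/q\mathbb{Z}$ is an $n\times n$ matrix with entries in $\mathbb{Z}/q\mathbb{Z}$ with prescribed row sums and column sums; $\Omega$ is the set of all of them. The Diaconis--Gangolli walk on $\Omega$: at each step pick uniformly at random a pair of distinct rows and a pair of distinct columns, and flip a fair coin. If heads, add $\begin{pmatrix}-1&1\\1&-1\end{pmatrix}$ to the $2\times 2$ submatrix formed by the chosen rows and columns; if tails, add its negative. Let $P$ be the transition matrix. A Markovian coupling of two copies of the walk is a Markov chain $(C^1_t,C^2_t)_{t\ge 0}$ on $\Omega\times\Omega$ such that, conditionally on $(C^1_{t-1},C^2_{t-1})=(x,y)$, the law of $C^1_t$ is $P(x,\cdot)$ and the law of $C^2_t$ is $P(y,\cdot)$. *)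

(* Defs.v *)
From mathcomp Require Import all_boot all_order all_algebra.
From mathcomp Require Import all_classical all_reals all_analysis.

Set Implicit Arguments.
Unset Strict Implicit.
Unset Printing Implicit Defensive.

Import Order.TTheory GRing.Theory Num.Theory.

Local Open Scope classical_set_scope.
Local Open Scope ring_scope.

(* 'Z_q is Z/qZ only when 1 < q, which has to be assumed separately.          *)
Definition is_table (n q : nat) (r c : 'I_n -> 'Z_q) : pred 'M['Z_q]_n :=
  fun A => [forall i, \sum_j A i j == r i] && [forall j, \sum_i A i j == c j].

Definition table (n q : nat) (r c : 'I_n -> 'Z_q) : Type :=
  {A : 'M['Z_q]_n | is_table r c A}.

(* An unordered pair of distinct indices, listed in increasing order.         *)
Definition index_pair (n : nat) : Type := {p : 'I_n * 'I_n | (p.1 < p.2)%N}.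

(* The outcome of one draw: a pair of rows, a pair of columns, and a coin     *)
(* (true for heads).                                                          *)
Definition draw (n : nat) : Type := (index_pair n * index_pair n * bool)%type.

Definition heads_mx (n q : nat) (rows cols : index_pair n) : 'M['Z_q]_n :=
  let: (i1, i2) := val rows in
  let: (j1, j2) := val cols in
  - delta_mx i1 j1 + delta_mx i1 j2 + delta_mx i2 j1 - delta_mx i2 j2.

Definition increment (n q : nat) (m : draw n) : 'M['Z_q]_n :=
  let: (rows, cols, heads) := m in
  if heads then heads_mx q rows cols else - heads_mx q rows cols.

(* The three choices are independent and uniform, so the draw is uniform on   *)
(* the product; distinct draws may have the same increment (e.g. if q = 2).   *)
Definition dg_walk (R : realType) (n q : nat) (r c : 'I_n -> 'Z_q)
    (x y : table r c) : R :=
  #|[pred m : draw n | val x + increment q m == val y]|%:R / #|{: draw n}|%:R.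

Section Coupling.
Context {R : realType} {d : measure_display} {T : measurableType d}.
Variable P : probability T R.

(* Only used when P B > 0.                                                    *)
Definition cond_prob (A B : set T) : R := fine (P (A `&` B)) / fine (P B).

(* A discrete-time Markov chain on a finite state space; its transition       *)
(* probabilities may depend on time.                                          *)
Definition markov_chain (S : finType) (X : nat -> T -> S) : Prop :=
  (forall (t : nat) (s : S), measurable [set w | X t w = s]) /\
  (forall (t : nat) (h : nat -> S) (s : S),
     let past := [set w | forall u, (u <= t)%N -> X u w = h u] in
     (0 < P past)%E ->
     cond_prob [set w | X t.+1 w = s] past =
     cond_prob [set w | X t.+1 w = s] [set w | X t w = h t]).

Definition markovian_coupling (S : finType) (p : S -> S -> R)
    (C1 C2 : nat -> T -> S) : Prop :=
  markov_chain (fun t w => (C1 t w, C2 t w)) /\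
  (forall (t : nat) (x y : S),
     let now := [set w | C1 t w = x /\ C2 t w = y] in
     (0 < P now)%E ->
     (forall z : S, cond_prob [set w | C1 t.+1 w = z] now = p x z) /\
     (forall z : S, cond_prob [set w | C2 t.+1 w = z] now = p y z)).

(* The minimum of the set of meeting times, and +oo if this set is empty.     *)
Definition coupling_time (S : Type) (C1 C2 : nat -> T -> S) (w : T) : \bar R :=
  ereal_inf [set (t%:R)%:E | t in [set t : nat | C1 t w = C2 t w]].

End Coupling.

(* Main.v *)
Require Import Defs.
From mathcomp Require Import all_boot all_order all_algebra.
From mathcomp Require Import all_classical all_reals all_analysis.
From mathcomp Require Import zify lra.

Set Implicit Arguments.
Unset Strict Implicit.
Unset Printing Implicit Defensive.

Import Order.TTheory GRing.Theory Num.Theory.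

(* If the two copies, in distinct states x and y, meet at z = x + M1 = y + M2, *)
(* then x - y = M2 - M1 is the difference of two moves. It has two nonzero     *)
(* rows a, b and two nonzero columns k, l, all covered by the two moves, and   *)
(* this forces M1 or M2 into families of moves with at most 8n and 6 members   *)
(* among the 2 C(n,2)^2 draws. Since the probability that both copies land on  *)
(* z is at most the minimum of the marginals, whatever the coupling, each step *)
(* makes unequal copies meet with probability at most (8n + 6) / (2 C(n,2)^2), *)
(* and a union bound over n^3 / 100 steps gives the result.                    *)

Local Open Scope ring_scope.

(** Coalescence is slow because the one-step laws from two distinct tables overlap little: under any
    coupling the copies land together with probability at most $\sum_z \min(P(x,z),P(y,z))$, which
    [dg_walk_overlap] bounds by a quantity of order $n/n^4$. The support of a move is a full
    rectangle of two rows by two columns. So a row of [x - y] met by only one move pins down the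
    columns of that move, while two moves that both use rows [a], [b] must together cover columns
    [k], [l]; [meeting_family] makes this a dichotomy. [meeting_step] transfers the overlap bound to
    the coupling, [prob_met_by] sums it over time, and [steps_card_draw] checks that the total stays
    below 1/2. *)

(** * Counting index pairs, draws and the two families of moves *)

Definition pair_set n (p : index_pair n) : {set 'I_n} := [set (val p).1; (val p).2].

Lemma pair_set_inj n : injective (@pair_set n).
Proof.
case=> [[i1 i2] /= lti] [[j1 j2] /= ltj]; rewrite /pair_set /= => /setP e.
apply/val_inj => /=.
move: (e i1) (e i2) (e j1) (e j2); rewrite !inE !eqxx ?orbT /=.
rewrite -!val_eqE /= => e1 e2 e3 e4.
by congr pair; apply/val_inj => /=; lia.
Qed.

(** Such a pair is [[set a; i]] for some [i]. *)
Lemma card_pair_set_mem n (a : 'I_n) :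
  (#|[pred p : index_pair n | a \in pair_set p]| <= n)%N.
Proof.
rewrite -(card_imset _ (@pair_set_inj n)) -[leqRHS]card_ord.
apply: leq_trans (leq_imset_card (fun i => [set a; i]) predT).
apply/subset_leq_card/fintype.subsetP => _ /imsetP [p + ->]; rewrite inE.
by case/set2P => ->; apply/imsetP;
  [exists (val p).2 | exists (val p).1]; rewrite // finset.setUC.
Qed.

Lemma card_pair_set_eq n (X : {set 'I_n}) :
  (#|[pred p : index_pair n | pair_set p == X]| <= 1)%N.
Proof.
by apply/card_le1_eqP => p p' /eqP <- /eqP /(@pair_set_inj n).
Qed.

Lemma card_index_pair_ge n : ('C(n, 2) <= #|{: index_pair n}|)%N.
Proof.
rewrite -[n in 'C(n, _)]card_ord -card_draws -(card_imset _ (@pair_set_inj n)).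
apply/subset_leq_card/fintype.subsetP => A; rewrite inE => /cards2P [i [j [ij ->]]].
apply/imsetP; have [lij|] := ltnP i j; first by exists (Sub (i, j) lij).
rewrite leq_eqVlt val_eqE eq_sym (negbTE ij) => lji.
by exists (Sub (j, i) lji) => //; rewrite /pair_set /= finset.setUC.
Qed.

Lemma card_draw_ge n : (2 * 'C(n, 2) ^ 2 <= #|{: draw n}|)%N.
Proof. by rewrite !card_prod card_bool mulnC leq_mul2r leq_mul ?card_index_pair_ge. Qed.

Lemma card_draw_product_le n (A B : pred (index_pair n)) (s t : nat) :
  (#|[pred p | A p]| <= s)%N -> (#|[pred p | B p]| <= t)%N ->
  (#|[pred m : draw n | A m.1.1 && B m.1.2]| <= 2 * (s * t))%N.
Proof.
move=> As Bt.
rewrite (_ : #|_| = #|[predX [predX A & B] & predT : pred bool]|)%N; last first.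
  by apply: eq_card => -[[p p'] b]; rewrite !inE andbT.
by rewrite !cardX card_bool mulnC leq_mul2l leq_mul.
Qed.

Lemma card_predU_le (T : finType) (A B : pred T) s t :
  (#|[pred x | A x]| <= s)%N -> (#|[pred x | B x]| <= t)%N ->
  (#|[pred x | A x || B x]| <= s + t)%N.
Proof.
move=> As Bt; apply: leq_trans (leq_add As Bt).
by rewrite -cardUI leq_addr.
Qed.

(* R, C are the row and column pairs of a move; Ja, Jb will be the supports of *)
(* rows a and b of x - y. A row of x - y met by only one of the two moves      *)
(* equals that row of the move up to sign, so it determines C.                 *)
Definition family1 n (a b k l : 'I_n) (Ja Jb R C : {set 'I_n}) : bool :=
  [|| (a \in R) && (C == Ja), (b \in R) && (C == Jb),
      (R == [set a; b]) && (k \in C) | (R == [set a; b]) && (l \in C)].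

Definition family2 n (a b k l : 'I_n) (Ja Jb R C : {set 'I_n}) : bool :=
  [|| (R == [set a; b]) && (C == Ja), (R == [set a; b]) && (C == Jb) |
      (R == [set a; b]) && (C == [set k; l])].

(** Each of the four clauses prescribes one pair and one element of the other, leaving at most [n]
    pairs and the coin: [2 * n] draws. *)
Lemma card_family1 n (a b k l : 'I_n) (Ja Jb : {set 'I_n}) :
  (#|[pred m : draw n | family1 a b k l Ja Jb (pair_set m.1.1) (pair_set m.1.2)]|
     <= 8 * n)%N.
Proof.
rewrite (_ : 8 * n = 2 * (n * 1) + (2 * (n * 1) + (2 * (1 * n) + 2 * (1 * n))))%N;
  last lia.
have le_in i := @card_pair_set_mem n i; have le_eq X := @card_pair_set_eq n X.
apply: card_predU_le; first exact: (card_draw_product_le (le_in a) (le_eq Ja)).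
apply: card_predU_le; first exact: (card_draw_product_le (le_in b) (le_eq Jb)).
apply: card_predU_le.
  exact: (card_draw_product_le (le_eq [set a; b]) (le_in k)).
exact: (card_draw_product_le (le_eq [set a; b]) (le_in l)).
Qed.

(** Each of the three clauses prescribes both pairs, leaving only the coin. *)
Lemma card_family2 n (a b k l : 'I_n) (Ja Jb : {set 'I_n}) :
  (#|[pred m : draw n | family2 a b k l Ja Jb (pair_set m.1.1) (pair_set m.1.2)]|
     <= 6)%N.
Proof.
rewrite (_ : 6 = 2 * (1 * 1) + (2 * (1 * 1) + 2 * (1 * 1)))%N //.
have le_eq X := @card_pair_set_eq n X.
have le_sub C : (#|[pred m : draw n |
    (pair_set m.1.1 == [set a; b]) && (pair_set m.1.2 == C)]| <= 2 * (1 * 1))%N.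
  exact: (card_draw_product_le (le_eq [set a; b]) (le_eq C)).
by do 2?[apply: card_predU_le => //].
Qed.

(** * Supports of moves and of differences of tables *)

(** The corner entries are 1 or -1, nonzero in ['Z_q] even when [q = 2] makes the two signs
    coincide. *)
Lemma increment_neq0 n q (m : draw n) (i j : 'I_n) :
  (increment q m i j != 0) = (i \in pair_set m.1.1) && (j \in pair_set m.1.2).
Proof.
case: m => [[rows cols] b] /=.
have -> : (if b then heads_mx q rows cols else - heads_mx q rows cols) i j != 0
    = (heads_mx q rows cols i j != 0) by case: b; rewrite // mxE oppr_eq0.
case: rows cols => [[i1 i2] /= lti] [[j1 j2] /= ltj].
rewrite /heads_mx /pair_set /= !mxE !inE.
(* The four unit matrices occupy distinct cells, so they neither add up nor cancel. *)
have i12 : ~~ ((i == i1) && (i == i2)).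
  by apply/andP => -[/eqP -> /eqP e]; rewrite e ltnn in lti.
have j12 : ~~ ((j == j1) && (j == j2)).
  by apply/andP => -[/eqP -> /eqP e]; rewrite e ltnn in ltj.
move: i12 j12; case: (i == i1); case: (i == i2); case: (j == j1);
  case: (j == j2) => //= _ _;
  rewrite ?mulr1n ?mulr0n ?subr0 ?sub0r ?oppr0 ?add0r ?addr0 ?oppr_eq0;
  by rewrite ?oner_eq0 ?eqxx.
Qed.

(** Supports let a family be tested on the matrix [z - x], which may come from several draws. *)
Definition row_support n q (M : 'M['Z_q]_n) : {set 'I_n} :=
  [set i | [exists j, M i j != 0]].
Definition col_support n q (M : 'M['Z_q]_n) : {set 'I_n} :=
  [set j | [exists i, M i j != 0]].

Lemma row_support_increment n q (m : draw n) :
  row_support (increment q m) = pair_set m.1.1.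
Proof.
apply/setP => i; rewrite inE; apply/existsP/idP => [[j]|im].
  by rewrite increment_neq0 => /andP [].
by exists (val m.1.2).1; rewrite increment_neq0 im /= set21.
Qed.

Lemma col_support_increment n q (m : draw n) :
  col_support (increment q m) = pair_set m.1.2.
Proof.
apply/setP => i; rewrite inE; apply/existsP/idP => [[j]|im].
  by rewrite increment_neq0 => /andP [].
by exists (val m.1.1).1; rewrite increment_neq0 im /= set21.
Qed.

Lemma pair_set_eq n (p : index_pair n) (a b : 'I_n) :
  a != b -> a \in pair_set p -> b \in pair_set p -> pair_set p = [set a; b].
Proof.
move=> ab ap bp; apply/eqP; rewrite eq_sym eqEcard finset.subUset !finset.sub1set ap bp /=.
by rewrite !cards2 ab; case: (_ != _).
Qed.

Lemma meeting_family n q (m1 m2 : draw n) (a b k l : 'I_n)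
    (D : 'M['Z_q]_n) (Ja := [set j | D a j != 0]) (Jb := [set j | D b j != 0]) :
  D = increment q m2 - increment q m1 ->
  a != b -> k != l -> D a k != 0 -> D a l != 0 -> D b k != 0 ->
  family1 a b k l Ja Jb (pair_set m1.1.1) (pair_set m1.1.2) ||
  family2 a b k l Ja Jb (pair_set m2.1.1) (pair_set m2.1.2).
Proof.
move=> eD ab kl ak al bk.
have out (m : draw n) i j : (i \notin pair_set m.1.1) || (j \notin pair_set m.1.2) ->
    increment q m i j = 0.
  by rewrite -negb_and -(increment_neq0 q) negbK => /eqP.
have DE i j : D i j = increment q m2 i j - increment q m1 i j by rewrite eD !mxE.
have D2 i : i \notin pair_set m2.1.1 ->
    forall j, (D i j != 0) = (i \in pair_set m1.1.1) && (j \in pair_set m1.1.2).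
  by move=> h j; rewrite DE out ?h// sub0r oppr_eq0 increment_neq0.
have D1 i : i \notin pair_set m1.1.1 ->
    forall j, (D i j != 0) = (i \in pair_set m2.1.1) && (j \in pair_set m2.1.2).
  by move=> h j; rewrite DE [X in _ - X]out ?h// subr0 increment_neq0.
have JaE j : (j \in Ja) = (D a j != 0) by rewrite inE.
have JbE j : (j \in Jb) = (D b j != 0) by rewrite inE.
rewrite /family1 /family2.
have [a2|a2] := boolP (a \in pair_set m2.1.1); last first.
  have a1 : a \in pair_set m1.1.1 by move: ak; rewrite D2 // => /andP [].
  rewrite a1 (_ : pair_set m1.1.2 == Ja) //.
  by apply/eqP/setP => j; rewrite JaE D2 // a1.
have [b2|b2] := boolP (b \in pair_set m2.1.1); last first.
  have b1 : b \in pair_set m1.1.1 by move: bk; rewrite D2 // => /andP [].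
  rewrite b1 (_ : pair_set m1.1.2 == Jb) ?orbT //.
  by apply/eqP/setP => j; rewrite JbE D2 // b1.
(* The second move now uses exactly rows [a] and [b]; a row missed by the first move reveals the
   columns of the second. *)
rewrite [pair_set m2.1.1](pair_set_eq ab a2 b2) eqxx.
have [a1|a1] := boolP (a \in pair_set m1.1.1); last first.
  rewrite (_ : pair_set m2.1.2 == Ja) ?orbT //.
  by apply/eqP/setP => j; rewrite JaE D1 // a2.
have [b1|b1] := boolP (b \in pair_set m1.1.1); last first.
  rewrite (_ : pair_set m2.1.2 == Jb) ?orbT //.
  by apply/eqP/setP => j; rewrite JbE D1 // b2.
(* Both moves use rows [a] and [b]. If the first avoids columns [k] and [l], the nonzero entries
   [D a k] and [D a l] come from the second. *)
rewrite [pair_set m1.1.1](pair_set_eq ab a1 b1) eqxx.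
have [|k1] := boolP (k \in pair_set m1.1.2); first by rewrite !orbT.
have [|l1] := boolP (l \in pair_set m1.1.2); first by rewrite !orbT.
rewrite (_ : pair_set m2.1.2 == [set k; l]) ?orbT //; apply/eqP/(pair_set_eq kl).
  by move: ak; rewrite DE [X in _ - X]out ?k1 ?orbT// subr0 increment_neq0 => /andP [].
by move: al; rewrite DE [X in _ - X]out ?l1 ?orbT// subr0 increment_neq0 => /andP [].
Qed.

Lemma sum0_other (V : zmodType) (I : finType) (F : I -> V) i :
  \sum_i F i = 0 -> F i != 0 -> exists2 j, i != j & F j != 0.
Proof.
move=> F0 Fi; have [/existsP [j /andP [ij Fj]]|/existsPn h] :=
  boolP [exists j, (i != j) && (F j != 0)]; first by exists j.
move: F0; rewrite (bigD1 i) //= big1 ?addr0 => [/eqP|j]; first by rewrite (negbTE Fi).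
by rewrite eq_sym => ij; have := h j; rewrite ij /= negbK => /eqP.
Qed.

(** The rows and columns of [x - y] sum to zero, so a nonzero entry has a nonzero companion in its
    row and another in its column. *)
Lemma table_diff n q (r c : 'I_n -> 'Z_q) (x y : table r c) : x != y ->
  exists a b k l, [/\ a != b, k != l, (val x - val y) a k != 0,
    (val x - val y) a l != 0 & (val x - val y) b k != 0].
Proof.
set D := val x - val y => xy.
have D0 : D != 0 by rewrite subr_eq0 (inj_eq val_inj).
have rD i : \sum_j D i j = 0.
  have /andP [/forallP /(_ i) /eqP xi _] := valP x.
  have /andP [/forallP /(_ i) /eqP yi _] := valP y.
  under eq_bigr do rewrite !mxE.
  by rewrite sumrB xi yi subrr.
have cD j : \sum_i D i j = 0.
  have /andP [_ /forallP /(_ j) /eqP xj] := valP x.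
  have /andP [_ /forallP /(_ j) /eqP yj] := valP y.
  under eq_bigr do rewrite !mxE.
  by rewrite sumrB xj yj subrr.
have [a [k ak]] : exists a k, D a k != 0.
  have [/existsP [a /existsP [k ak]]|/existsPn h] :=
    boolP [exists a, exists k, D a k != 0]; first by exists a, k.
  case/eqP: D0; apply/matrixP => i j; rewrite [RHS]mxE.
  by have /existsPn /(_ j) := h i; rewrite negbK => /eqP.
have [l kl al] := sum0_other (rD a) ak.
have [b ab bk] := sum0_other (cD k) ak.
by exists a, b, k, l.
Qed.

(** * Overlap of the one-step laws *)

(** Each draw takes [x] to at most one table, so after exchanging the sums it is counted at most
    once. *)
Lemma sum_card_fibers n q (r c : 'I_n -> 'Z_q) (x : table r c)
    (Q : pred 'M['Z_q]_n) :
  (\sum_(z : table r c | Q (val z - val x)%R)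
     #|[pred m : draw n | (val x + increment q m)%R == val z]|
   <= #|[pred m : draw n | Q (increment q m)]|)%N.
Proof.
under eq_bigr do rewrite -sum1_card.
rewrite (exchange_big_dep (fun m => Q (increment q m))) /=; last first.
  by move=> z m Qz /eqP e; rewrite -e addrAC subrr add0r in Qz.
rewrite -sum1_card leq_sum // => m _; rewrite sum1_card.
apply/card_le1_eqP => z z' /andP [_ /eqP e] /andP [_ /eqP e'].
by apply/val_inj; exact: etrans (esym e') e.
Qed.

Lemma sum_dg_walk_le (R : realType) n q (r c : 'I_n -> 'Z_q) (x : table r c)
    (Q : pred 'M['Z_q]_n) s :
  (#|[pred m : draw n | Q (increment q m)]| <= s)%N ->
  \sum_(z | Q (val z - val x)%R) dg_walk R x z <= s%:R / #|{: draw n}|%:R.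
Proof.
move=> le_s; rewrite /dg_walk -mulr_suml -natr_sum ler_wpM2r ?invr_ge0 //.
by rewrite ler_nat (leq_trans (sum_card_fibers x Q)).
Qed.

Lemma dg_walk_ge0 (R : realType) n q (r c : 'I_n -> 'Z_q) (x z : table r c) :
  0 <= dg_walk R x z.
Proof. by rewrite /dg_walk divr_ge0. Qed.

Lemma dg_walk_neq0 (R : realType) n q (r c : 'I_n -> 'Z_q) (x z : table r c) :
  dg_walk R x z != 0 -> exists m, val z - val x = increment q m.
Proof.
rewrite /dg_walk mulf_eq0 negb_or => /andP [+ _].
rewrite pnatr_eq0 -lt0n => /card_gt0P [m]; rewrite inE => /eqP <-.
by exists m; rewrite addrAC subrr add0r.
Qed.

(** Pointwise, the minimum is at most $P(x,z)$ if [z - x] fits [family1], at most $P(y,z)$ if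
    [z - y] fits [family2], and zero otherwise by [meeting_family]. *)
Lemma dg_walk_overlap (R : realType) n q (r c : 'I_n -> 'Z_q)
    (x y : table r c) : x != y ->
  \sum_z Num.min (dg_walk R x z) (dg_walk R y z)
    <= (8 * n + 6)%:R / #|{: draw n}|%:R.
Proof.
move=> xy; have [a [b [k [l [ab kl ak al bk]]]]] := table_diff xy.
set D := val x - val y in ak al bk.
set Ja := [set j | D a j != 0]; set Jb := [set j | D b j != 0].
pose Q1 (M : 'M['Z_q]_n) := family1 a b k l Ja Jb (row_support M) (col_support M).
pose Q2 (M : 'M['Z_q]_n) := family2 a b k l Ja Jb (row_support M) (col_support M).
have le1 : (#|[pred m : draw n | Q1 (increment q m)]| <= 8 * n)%N.
  apply: leq_trans (card_family1 a b k l Ja Jb); apply: eq_leq; apply: eq_card => m.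
  by rewrite !inE /Q1 row_support_increment col_support_increment.
have le2 : (#|[pred m : draw n | Q2 (increment q m)]| <= 6)%N.
  apply: leq_trans (card_family2 a b k l Ja Jb); apply: eq_leq; apply: eq_card => m.
  by rewrite !inE /Q2 row_support_increment col_support_increment.
rewrite natrD mulrDl.
apply: le_trans (lerD (sum_dg_walk_le R x le1) (sum_dg_walk_le R y le2)).
rewrite (big_mkcond (fun z => Q1 _)) (big_mkcond (fun z => Q2 _)) -big_split /=.
apply: ler_sum => z _; rewrite ge_min.
have p0 := dg_walk_ge0 R; have [q1|q1] := boolP (Q1 _).
  by rewrite lerDl; case: ifP; rewrite ?p0 ?lexx.
have [q2|q2] := boolP (Q2 _); first by rewrite add0r lexx orbT.
rewrite addr0.
have [->|/dg_walk_neq0 [m1 e1]] := eqVneq (dg_walk R x z) 0; first by rewrite lexx.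
have [->|/dg_walk_neq0 [m2 e2]] := eqVneq (dg_walk R y z) 0; first by rewrite lexx orbT.
have eD : D = increment q m2 - increment q m1.
  by rewrite -e1 -e2 opprB [RHS]addrC addrA subrK.
have := meeting_family eD ab kl ak al bk.
rewrite -!(row_support_increment q) -!(col_support_increment q) -e1 -e2.
by rewrite -/(Q1 _) -/(Q2 _) (negbTE q1) (negbTE q2).
Qed.

Local Open Scope classical_set_scope.

(** * Meeting probabilities of a Markovian coupling *)

Lemma measure_bigsetU_le d (T : measurableType d) (R : realType)
    (mu : {measure set T -> \bar R}) (I : Type) (s : seq I) (Q : pred I)
    (F : I -> set T) :
  (forall i, measurable (F i)) ->
  (mu (\big[setU/set0]_(i <- s | Q i) F i) <= \sum_(i <- s | Q i) mu (F i))%E.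
Proof.
move=> mF; elim: s => [|i s IH]; first by rewrite !big_nil measure0.
rewrite !big_cons; case: ifP => // _.
apply: le_trans (measureU2 mu _ _) _ => //; first exact: bigsetU_measurable.
exact: leeD2l.
Qed.

Section Coupling.
Context {R : realType} {d : measure_display} {T : measurableType d}.
Variables (P : probability T R) (S : finType) (p : S -> S -> R).
Variables (C1 C2 : nat -> T -> S).
Hypothesis hC : markovian_coupling P p C1 C2.

Definition joint t (s : S * S) : set T := [set w | C1 t w = s.1 /\ C2 t w = s.2].

Lemma measurable_joint t s : measurable (joint t s).
Proof.
rewrite (_ : joint t s = [set w | (C1 t w, C2 t w) = s]); first exact: hC.1.1.
case: s => x y; apply/seteqP.
by split=> w /=; [case=> /= -> ->|rewrite /joint /=; case=> -> ->].
Qed.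

Lemma joint_event t (Q : pred (S * S)) :
  [set w | Q (C1 t w, C2 t w)] = \big[setU/set0]_(s | Q s) joint t s.
Proof.
rewrite -bigcup_pred; apply/seteqP; split=> w /=.
  by move=> Qw; exists (C1 t w, C2 t w).
by case=> -[x y] /= Qxy [/= -> ->].
Qed.

Lemma measurable_joint_event t (Q : pred (S * S)) :
  measurable [set w | Q (C1 t w, C2 t w)].
Proof.
by rewrite joint_event; apply: bigsetU_measurable => s _; exact: measurable_joint.
Qed.

Lemma sum_joint t : (\sum_s P (joint t s) = 1)%E.
Proof.
rewrite fsbig_seq ?index_enum_uniq // -measure_fin_bigcup //.
- rewrite -(probability_setT P); congr (P _); apply/seteqP; split=> // w _.
  by exists (C1 t w, C2 t w) => //=; rewrite mem_index_enum.
- by move=> [x y] [x' y'] _ _ [w [[/= <- <-] [/= <- <-]]].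
- by move=> s _; exact: measurable_joint.
Qed.

Lemma measurable_coord t z :
  measurable [set w | C1 t w = z] /\ measurable [set w | C2 t w = z].
Proof.
split.
  rewrite (_ : [set _ | _] = [set w | (C1 t w, C2 t w).1 == z]).
    exact: (measurable_joint_event t (fun s => s.1 == z)).
  by apply/seteqP; split=> w /= /eqP.
rewrite (_ : [set _ | _] = [set w | (C1 t w, C2 t w).2 == z]).
  exact: (measurable_joint_event t (fun s => s.2 == z)).
by apply/seteqP; split=> w /= /eqP.
Qed.

Lemma cond_probK (A B : set T) : measurable A -> measurable B -> (0 < P B)%E ->
  (P (A `&` B) = P B * (cond_prob P A B)%:E)%E.
Proof.
move=> mA mB PB; have fB := fin_num_measure P B mB.
have fAB := fin_num_measure P _ (measurableI _ _ mA mB).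
rewrite -[LHS]fineK // -[X in (X * _)%E]fineK // -EFinM /cond_prob mulrC divfK //.
by rewrite fine_eq0 // gt_eqF.
Qed.

(** The event makes the first copy go from [x] to [z] and the second from [y] to [z], so either
    marginal bounds it. *)
Lemma joint_step t x y z :
  (P (joint t (x, y) `&` joint t.+1 (z, z))
     <= P (joint t (x, y)) * (Num.min (p x z) (p y z))%:E)%E.
Proof.
have mxy := measurable_joint t (x, y); have mzz := measurable_joint t.+1 (z, z).
have [mz1 mz2] := measurable_coord t.+1 z.
(* The marginals are prescribed only at states of positive probability; null states are treated
   apart. *)
have [P0|] := eqVneq (P (joint t (x, y))) 0%E.
  by rewrite P0 mul0e -P0 le_measure ?inE //; exact: measurableI.
rewrite -measure_gt0 => Ppos.
have [e1 e2] := hC.2 t x y Ppos; rewrite minEle; case: ifP => _.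
  rewrite -e1 -cond_probK // le_measure ?inE; [by []|exact: measurableI..|].
  by move=> w [jw [zw _]].
rewrite -e2 -cond_probK // le_measure ?inE; [by []|exact: measurableI..|].
by move=> w [jw [_ zw]].
Qed.

(** Split by the state at time [t] and the meeting point [z]; each unequal state contributes at most
    [e] times its probability. *)
Lemma meeting_step t (e : R) : 0 <= e ->
  (forall x y, x != y -> \sum_z Num.min (p x z) (p y z) <= e) ->
  (P [set w | C1 t w <> C2 t w /\ C1 t.+1 w = C2 t.+1 w] <= e%:E)%E.
Proof.
move=> e0 ple.
pose F s := \big[setU/set0]_z (joint t s `&` joint t.+1 (z, z)).
have mI s z : measurable (joint t s `&` joint t.+1 (z, z)).
  by apply: measurableI; exact: measurable_joint.
have mF s : measurable (F s) by apply: bigsetU_measurable.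
rewrite (_ : [set _ | _] = \big[setU/set0]_(s | s.1 != s.2) F s); last first.
  rewrite -bigcup_pred; apply/seteqP; split=> w /=.
    move=> [ne e']; exists (C1 t w, C2 t w); first exact/eqP.
    rewrite /F -bigcup_pred; exists (C1 t.+1 w) => //; split => //.
  case=> -[x y] /= /eqP xy; rewrite /F -bigcup_pred => -[z _ [[/= -> ->] [/= -> ->]]].
  by split.
apply: le_trans (measure_bigsetU_le P _ _ mF) _.
apply: (@le_trans _ _ (\sum_s P (joint t s) * e%:E)%E); last first.
  rewrite -ge0_sume_distrl ?sum_joint ?mul1e // => s _; exact: measure_ge0.
rewrite big_mkcond /=; apply: lee_sum => -[x y] _ /=.
case: ifP => [xy|_]; last by rewrite mule_ge0 ?lee_fin.
apply: le_trans (measure_bigsetU_le P _ _ (mI _)) _.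
apply: (@le_trans _ _ (\sum_z P (joint t (x, y)) * (Num.min (p x z) (p y z))%:E)%E).
  by apply: lee_sum => z _; exact: joint_step.
rewrite -(fineK (fin_num_measure P _ (measurable_joint t (x, y)))).
under eq_bigr do rewrite -EFinM.
by rewrite sumEFin -mulr_sumr -EFinM lee_fin ler_wpM2l ?fine_ge0 ?ple.
Qed.

Lemma measurable_meet t : measurable [set w | C1 t w = C2 t w].
Proof.
rewrite (_ : [set _ | _] = [set w | (C1 t w, C2 t w).1 == (C1 t w, C2 t w).2]).
  exact: (measurable_joint_event t (fun s => s.1 == s.2)).
by apply/seteqP; split=> w /= /eqP.
Qed.

(** The copies may separate after meeting, so this asks for a meeting at some time up to [K], not
    for equality at time [K]. *)
Definition met_by K : set T := [set w | exists2 t, (t <= K)%N & C1 t w = C2 t w].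

Lemma measurable_met_by K : measurable (met_by K).
Proof.
rewrite (_ : met_by K = \bigcup_(t in [set t | (t <= K)%N]) [set w | C1 t w = C2 t w]).
  by apply: bigcup_measurable => t _; exact: measurable_meet.
by apply/seteqP; split=> w [t tK e]; exists t.
Qed.

(** A first meeting after time 0 is a step from unequal to equal copies, so each step adds at most
    [e]. *)
Lemma prob_met_by K (e : R) : 0 <= e ->
  (forall x y, x != y -> \sum_z Num.min (p x z) (p y z) <= e) ->
  P [set w | C1 0%N w = C2 0%N w] = 0%E ->
  (P (met_by K) <= (K%:R * e)%:E)%E.
Proof.
move=> e0 ple P0; elim: K => [|K IH].
  rewrite mul0r (_ : met_by 0 = [set w | C1 0%N w = C2 0%N w]) ?P0 //.
  apply/seteqP; split=> [w [t]|w e']; last by exists 0%N.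
  by rewrite leqn0 => /eqP ->.
set step := [set w | C1 K w <> C2 K w /\ C1 K.+1 w = C2 K.+1 w].
have mstep : measurable step.
  rewrite (_ : step = ~` [set w | C1 K w = C2 K w] `&`
                      [set w | C1 K.+1 w = C2 K.+1 w]) //.
  by apply: measurableI; [apply: measurableC|]; exact: measurable_meet.
have sub : met_by K.+1 `<=` met_by K `|` step.
  move=> w [t tK e'].
  have [eK|neK] := pselect (C1 K w = C2 K w); first by left; exists K.
  move: tK; rewrite leq_eqVlt => /predU1P [tK|tK]; last by left; exists t.
  by right; split => //; rewrite -tK.
have mU : measurable (met_by K `|` step).
  by apply: measurableU => //; exact: measurable_met_by.
apply: (@le_trans _ _ (P (met_by K `|` step))).
  by rewrite le_measure ?inE //; exact: measurable_met_by.
apply: le_trans (measureU2 P (measurable_met_by K) mstep) _.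
rewrite -natr1 mulrDl mul1r EFinD leeD //; exact: meeting_step.
Qed.

End Coupling.

(** * Integer part of the time bound, arithmetic and conclusion *)

(** The coupling time is a natural number or [+oo], so exceeding [x] means not meeting up to its
    integer part [K]. *)
Lemma lt_coupling_time (R : realType) d (T : measurableType d) (S : Type)
    (C1 C2 : nat -> T -> S) (x : R) (K : nat) : K%:R <= x < K.+1%:R ->
  [set w | (x%:E < coupling_time (R := R) C1 C2 w)%E] =
  ~` [set w | exists2 t, (t <= K)%N & C1 t w = C2 t w].
Proof.
move=> /andP [Kx xK]; apply/seteqP; split=> w /=.
  move=> lt_x [t tK e]; move: lt_x; apply/negP; rewrite -leNgt.
  apply: (@le_trans _ _ (t%:R%:E)); first by apply: ereal_inf_lbound; exists t.
  by rewrite lee_fin (le_trans _ Kx) // ler_nat.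
move=> nmet; apply: (@lt_le_trans _ _ (K.+1%:R%:E)); first by rewrite lte_fin.
apply: le_ereal_inf_tmp => _ [t /= e <-]; rewrite lee_fin ler_nat ltnNge.
by apply/negP => tK; apply: nmet; exists t.
Qed.

(** As there are at least $n^2(n-1)^2/2$ draws and $100K\le n^3$, it suffices that $n(8n+6)\le
    25(n-1)^2$, which holds for $n\ge4$. *)
Lemma steps_card_draw n : (4 <= n)%N ->
  (2 * (n ^ 3 %/ 100 * (8 * n + 6)) <= #|{: draw n}|)%N.
Proof.
move=> n4; apply: leq_trans (card_draw_ge n).
have : (2 * 'C(n, 2) = n * n.-1)%N by rewrite mulnC (bin_ffact n 2) ffactnS ffactn1.
have := leq_trunc_div (n ^ 3) 100.
move: (n ^ 3 %/ 100)%N 'C(n, 2) => K C; rewrite !expnS !expn0 !muln1.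
case: n n4 => // m m3 /= le_K eC.
have le_m : (m.+1 * (8 * m.+1 + 6) <= 25 * (m * m))%N by nia.
have le1 : (100 * (K * (8 * m.+1 + 6)) <= (m.+1 * m.+1) * (25 * (m * m)))%N.
  apply: leq_trans (leq_mul (leqnn (m.+1 * m.+1)) le_m).
  rewrite (_ : 100 * _ = K * 100 * (8 * m.+1 + 6))%N; last lia.
  by rewrite !mulnA leq_mul2r -!mulnA le_K orbT.
have e4 : (4 * (C * C) = (m.+1 * m.+1) * (m * m))%N.
  by rewrite (_ : 4 * _ = (2 * C) * (2 * C))%N ?eC; lia.
lia.
Qed.

Theorem proposition1p3 (n q : nat) (hn : (4 <= n)%N) (hq : (2 <= q)%N)
    (r c : 'I_n -> 'Z_q) (hrc : \sum_i r i = \sum_j c j)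
    (R : realType) (d : measure_display) (T : measurableType d)
    (P : probability T R) (C1 C2 : nat -> T -> table r c)
    (hC : markovian_coupling P (@dg_walk R n q r c) C1 C2)
    (x0 y0 : table r c) (hxy : x0 <> y0)
    (h0 : P [set w | C1 0%N w = x0 /\ C2 0%N w = y0] = 1%E) :
  ((2^-1)%:E <=
     P [set w | (n%:R ^+ 3 / 100)%:E < coupling_time (R := R) C1 C2 w])%E.
Proof.
set K := (n ^ 3 %/ 100)%N.
pose e : R := (8 * n + 6)%:R / #|{: draw n}|%:R.
have Ke : K%:R * e <= 2^-1.
  have draw0 : (0 : R) < #|{: draw n}|%:R.
    rewrite ltr0n; apply: leq_trans (card_draw_ge n).
    by rewrite muln_gt0 expn_gt0 bin_gt0 (leq_trans _ hn).
  rewrite /e mulrA ler_pdivrMr // ler_pdivlMl // -!natrM ler_nat.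
  exact: steps_card_draw.
have e0 : 0 <= e by rewrite divr_ge0.
have ple := @dg_walk_overlap R n q r c.
(* The starting states are fixed only almost surely, so an initial meeting is a null event. *)
have P0 : P [set w | C1 0%N w = C2 0%N w] = 0%E.
  apply: (@subset_measure0 _ _ _ _ _ (~` joint C1 C2 0 (x0, y0))).
  - exact: (measurable_meet hC).
  - exact/measurableC/(measurable_joint hC).
  - by move=> w /= eC [/= e1 e2]; apply: hxy; rewrite -e1 -e2.
  - apply: etrans (probability_setC P (measurable_joint hC 0 (x0, y0))) _.
    by rewrite [X in (1 - X)%E]h0 subee.
rewrite (@lt_coupling_time _ _ _ _ _ _ _ K); last first.
  rewrite ler_pdivlMr // ltr_pdivrMr // -!natrX -!natrM ler_nat ltr_nat.
  by rewrite leq_trunc_div ltn_ceil.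
rewrite probability_setC; last exact: (measurable_met_by hC).
have := prob_met_by hC K e0 ple P0.
rewrite -(fineK (fin_num_measure P _ (measurable_met_by hC K))) -/(met_by C1 C2 K).
by rewrite -EFinB !lee_fin => le_e; lra.
Qed.
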